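(* Let $m,n$ be positive integers and let $S(K_{m,n},-)$ be the set of all unbalanced signed graphs whose underlying graph is the complete bipartite graph $K_{m,n}$ on $m+n$ vertices. Let $\Gamma^*$ be an unbalanced signed graph with underlying graph $K_{m,n}$ that contains exactly one negative edge. If $\Gamma\in S(K_{m,n},-)$, then $EE(\Gamma^* )\ge EE(\Gamma)$, with equality if and only if $\Gamma$ is switching equivalent to $\Gamma^*$.
   Context: A signed graph $\Gamma=(G,\sigma)$ is a finite simple graph $G$ together with a function $\sigma:E(G)\to\{-1,1\}$. Its adjacency matrix $A_\Gamma$ is the symmetric matrix with $(i,j)$ entry $\sigma(ij)$ if $ij\in E(G)$ and $0$ otherwise; the eigenvalues of $\Gamma$ are those of $A_\Gamma$, counted with multiplicity. The Estrada index is $EE(\Gamma)=\sum_i e^{\mu_i}$, the sum being over all eigenvalues $\mu_i$ of $\Gamma$. The sign of a cycle is the product of the signs of its edges; a signed graph is balanced if all its cycles are positive, and unbalanced otherwise. For $Z\subseteq V(\Gamma)$, switching with respect to $Z$ reverses the signs of all edges with exactly one endpoint in $Z$. Two signed graphs are called switching equivalent if one can be obtained from the other by switching, where signed graphs are considered up to isomorphism (relabelling of vertices). *)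

(* Defs.v *)
From HB Require Import structures.
From mathcomp Require Import all_boot all_order all_algebra.
From mathcomp Require Import all_classical all_reals all_analysis.

Set Implicit Arguments.
Unset Strict Implicit.
Unset Printing Implicit Defensive.

Import Order.TTheory GRing.Theory Num.Theory.
Local Open Scope ring_scope.

(* The signature is a function on edges: the value of [sign] on a pair of
   non-adjacent vertices is junk, and nothing below depends on it. *)
Record signed_graph (V : finType) := SignedGraph {
  edge : rel V;
  sign : V -> V -> int;
  edge_sym : symmetric edge;
  edge_irr : irreflexive edge;
  sign_sym : forall u v, edge u v -> sign u v = sign v u;
  sign_pm1 : forall u v, edge u v -> sign u v = 1 \/ sign u v = -1 }.

Definition adj_mx (R : realType) (V : finType) (G : signed_graph V) :
    'M[R]_#|V| :=
  \matrix_(i, j) if edge G (enum_val i) (enum_val j)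
                 then (sign G (enum_val i) (enum_val j))%:~R else 0.

(* The eigenvalue [mu] is counted with its multiplicity as a root of the
   characteristic polynomial. *)
Definition estrada (R : realType) (V : finType) (G : signed_graph V) : R :=
  \sum_(mu \in [set x : R | eigenvalue (adj_mx R G) x]%classic)
    expR mu *+ mup mu (char_poly (adj_mx R G)).

(* [ucycle] alone accepts the closed walks [::] and [:: u; v]. *)
Definition is_cycle (V : finType) (G : signed_graph V) (c : seq V) : Prop :=
  (2 < size c)%N /\ ucycle (edge G) c.

Definition cycle_sign (V : finType) (G : signed_graph V) (c : seq V) : int :=
  \prod_(x <- c) sign G x (next c x).

Definition balanced (V : finType) (G : signed_graph V) : Prop :=
  forall c : seq V, is_cycle G c -> cycle_sign G c = 1.

Definition unbalanced (V : finType) (G : signed_graph V) : Prop :=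
  ~ balanced G.

Definition negative_edges (V : finType) (G : signed_graph V) : {set {set V}} :=
  [set [set p.1; p.2] | p : V * V & edge G p.1 p.2 && (sign G p.1 p.2 == -1)].

Section Switching.
Variables (V : finType) (G : signed_graph V) (Z : {set V}).

Definition switch_sign (u v : V) : int :=
  if (u \in Z) (+) (v \in Z) then - sign G u v else sign G u v.

Lemma switch_sign_sym u v : edge G u v -> switch_sign u v = switch_sign v u.
Proof. by move=> uv; rewrite /switch_sign addbC (sign_sym uv). Qed.

Lemma switch_sign_pm1 u v :
  edge G u v -> switch_sign u v = 1 \/ switch_sign u v = -1.
Proof.
move=> uv; rewrite /switch_sign.
by case: ifP => _; case: (sign_pm1 uv) => ->; rewrite ?opprK; [right|left|left|right].
Qed.

Definition switch : signed_graph V :=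
  SignedGraph (edge_sym G) (edge_irr G) switch_sign_sym switch_sign_pm1.

End Switching.

Definition sg_iso (V W : finType) (G : signed_graph V) (H : signed_graph W) :
    Prop :=
  exists f : V -> W,
    [/\ bijective f,
        forall u v, edge H (f u) (f v) = edge G u v
      & forall u v, edge G u v -> sign H (f u) (f v) = sign G u v].

Definition switching_equivalent (V W : finType)
    (G : signed_graph V) (H : signed_graph W) : Prop :=
  exists Z : {set V}, sg_iso (switch G Z) H.

Definition Kmn (m n : nat) : rel ('I_m + 'I_n) :=
  fun a b => match a, b with
             | inl _, inr _ | inr _, inl _ => true
             | _, _ => false
             end.

Definition underlying_Kmn (m n : nat) (V : finType) (G : signed_graph V) :
    Prop :=
  exists f : V -> 'I_m + 'I_n,
    bijective f /\ forall u v, edge G u v = Kmn (f u) (f v).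

(* Membership in the set S(K_{m,n}, -), with vertices in an arbitrary finite
   type. *)
Definition unbalanced_Kmn (m n : nat) (V : finType) (G : signed_graph V) :
    Prop :=
  underlying_Kmn m n G /\ unbalanced G.

(* Main.v *)
(* Let [B] be the m x n matrix of the signs of the edges, and [x_i] the
   eigenvalues of [B B^T]. Then [EE = n - m + 2 sum_i cosh (sqrt x_i)], so [EE]
   increases with every power sum of the [x_i]; their sum is always [m n].
   For one negative edge, [B] has rank at most 2, so the nonzero [x_i] are among
   some [a >= b]. For any unbalanced signature all [x_i] are at most [a]: after
   passing to absolute values in a top singular pair, the switched matrix still
   has a negative entry, and making all its other entries positive can only
   increase the norm. Hence [x] is majorized by [(a, b, 0, ..., 0)], which bounds
   every power sum.
   If equality holds, then [tr ((B B^T)^2)] is extremal, which means that [B] has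
   as few negative 4-cycles as if it had one negative entry; counting them by
   pairs of rows shows that [B] is a switching of such a matrix. *)
Require Import Defs.
From mathcomp Require Import all_boot all_order all_algebra.
From mathcomp Require Import all_classical all_reals all_analysis.
From mathcomp Require Import perm sesquilinear spectral complex ring lra zify.

Set Implicit Arguments.
Unset Strict Implicit.
Unset Printing Implicit Defensive.

Import numFieldNormedType.Exports.
Import Order.TTheory GRing.Theory Num.Theory.
Local Open Scope ring_scope.

(** * Real symmetric matrices *)

Lemma char_poly_similar (F : fieldType) n (P A B : 'M[F]_n) :
  P \in unitmx -> P *m A = B *m P -> char_poly A = char_poly B.
Proof.
move=> Pu PAB; pose Q := map_mx polyC P.
have Qn0 : \det Q != 0.
  by rewrite det_map_mx polyC_eq0 -unitfE -unitmxE.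
apply: (mulfI Qn0); rewrite [RHS]mulrC /char_poly -!det_mulmx; congr (\det _).
rewrite /char_poly_mx mulmxBr mulmxBl mul_mx_scalar mul_scalar_mx.
by rewrite -!map_mxM PAB.
Qed.

(** [E] selects the coordinates with nonzero diagonal entry and [G] divides by these entries, so
    [E *m diag_mx d *m G] is the identity of size [#|S|]. *)
Lemma leq_rank_diag_mx (F : fieldType) n (d : 'rV[F]_n) :
  (#|[pred i | d 0%R i != 0%R]| <= \rank (diag_mx d))%N.
Proof.
set S := [pred i | _].
pose E : 'M[F]_(#|S|, n) := \matrix_(k, j) (enum_val k == j)%:R.
pose G : 'M[F]_(n, #|S|) := \matrix_(j, k) ((enum_val k == j)%:R / d 0 j).
have EDG : E *m diag_mx d *m G = 1%:M.
  apply/matrixP => k l; rewrite mul_mx_diag !mxE (bigD1 (enum_val k)) //=.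
  rewrite !mxE eqxx mul1r big1 ?addr0 => [|j jk]; last first.
    by rewrite !mxE eq_sym (negbTE jk) !mul0r.
  rewrite (inj_eq enum_val_inj) eq_sym mulrCA divff ?mulr1 //.
  exact: (enum_valP k).
rewrite -[X in (X <= _)%N](mxrank1 F) -EDG.
by rewrite (leq_trans (mxrankM_maxl _ _)) ?mxrankM_maxr.
Qed.

(** Over [R[i]] the matrix is Hermitian, so a unitary [P] diagonalises it with real eigenvalues, and
    each identity descends to [R]. The last clause is the Rayleigh bound. *)
Lemma symmetric_spectral (R : realType) n (M : 'M[R]_n) : M^T = M ->
  exists d : 'I_n -> R,
  [/\ char_poly M = \prod_i ('X - (d i)%:P),
      \tr M = \sum_i d i, \tr (M *m M) = \sum_i d i ^+ 2,
      (#|[pred i | d i != 0%R]| <= \rank M)%N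
    & forall a, (forall i, d i <= a) ->
      forall u : 'rV_n, (u *m M *m u^T) 0 0 <= a * (u *m u^T) 0 0].
Proof.
move=> Msym; pose c := real_complex R; pose A : 'M[R[i]]_n := map_mx c M.
have cconj x : (c x)^* = c x by apply/eqP; rewrite eq_complex /= oppr0 !eqxx.
have creal x : c x \is Num.real by apply/CrealP.
have Asym : A \is symmetricmx.
  by apply/is_hermitianmxP/matrixP => i j; rewrite !mxE mul1r -{1}Msym mxE.
have Areal : A \is a mxOver Num.real by apply/mxOverP => i j; rewrite mxE.
have /orthomx_spectralP := symmetric_normalmx Asym Areal.
have /mxOverP := hermitian_spectral_diag_real (realsym_hermsym Asym Areal).
have := spectral_unitarymx A.
move: (spectralmx A) (spectral_diag A) => P sp Punit spreal AE.
have Pu := unitarymx_unit Punit.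
pose d i : R := complex.Re (sp 0 i).
have dE i : sp 0 i = c (d i) by rewrite /d /c RRe_real.
have PA : P *m A = diag_mx sp *m P by rewrite AE !mulmxA mulmxV // mul1mx.
exists d; split.
- apply: (map_poly_inj c).
  rewrite map_char_poly -/A (char_poly_similar Pu PA).
  rewrite char_poly_trig ?diag_mx_is_trig // rmorph_prod.
  by apply: eq_bigr => i _; rewrite /= map_polyXsubC mxE eqxx dE.
- apply: (fmorph_inj c).
  rewrite -trace_map_mx -/A AE mxtrace_mulC !mulmxA mulmxV // mul1mx.
  by rewrite mxtrace_diag rmorph_sum; apply: eq_bigr.
- apply: (fmorph_inj c).
  rewrite -trace_map_mx map_mxM -/A.
  have -> : A *m A = invmx P *m (diag_mx sp *m diag_mx sp) *m P.
    by rewrite {1}AE -!mulmxA PA.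
  rewrite mxtrace_mulC !mulmxA mulmxV // mul1mx mulmx_diag.
  rewrite mxtrace_diag rmorph_sum; apply: eq_bigr => i _.
  by rewrite mxE dE rmorphXn.
- rewrite -(mxrank_map c) -/A.
  have -> : \rank A = \rank (diag_mx sp).
    rewrite AE mxrankMfree ?row_free_unit // mulmxE.
    by rewrite -mxrank_tr trmx_mul mxrankMfree ?mxrank_tr // row_free_unit
       unitmx_tr unitmx_inv.
  rewrite (leq_trans _ (leq_rank_diag_mx sp)) // subset_leq_card //.
  by apply/fintype.subsetP => i; rewrite !inE dE fmorph_eq0.
(* [w] holds the coordinates of [u] in the eigenbasis: the norm is preserved and the form becomes
   the sum of the [d i * |w_i|^2]. *)
move=> a da u; pose v := map_mx c u; pose w := v *m (P^t*)%sesqui.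
have vE : (v^t*)%sesqui = map_mx c u^T.
  by apply/matrixP => i j; rewrite !mxE cconj.
have wE : (w^t*)%sesqui = P *m (v^t*)%sesqui.
  by rewrite /w trmx_mul map_mxM trmxCK.

have normw : \sum_i `|w 0 i| ^+ 2 = c ((u *m u^T) 0 0).
  transitivity ((w *m (w^t*)%sesqui) 0 0).
    by rewrite !mxE; apply: eq_bigr => i _; rewrite !mxE normCK.
  rewrite wE mulmxA /w -(mulmxA v) -invmx_unitary //.
  by rewrite mulVmx // mulmx1 vE -map_mxM mxE.
have cM x y : c (x * y) = c x * c y by exact: (rmorphM c).
rewrite -lecR -/(c ((u *m M *m u^T) 0 0)) -/(c (a * _)) cM.
have -> : c ((u *m M *m u^T) 0 0) = \sum_i c (d i) * `|w 0 i| ^+ 2.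
  transitivity ((w *m diag_mx sp *m (w^t*)%sesqui) 0 0).
    have -> : w *m diag_mx sp *m (w^t*)%sesqui = v *m A *m (v^t*)%sesqui.
      by rewrite wE /w AE invmx_unitary // !mulmxA.
    rewrite vE.
    by rewrite /v /A -!map_mxM [RHS]mxE.
  rewrite mxE; apply: eq_bigr => i _.
  rewrite mul_mx_diag [X in X * _]mxE [X in _ * X]mxE [in X in _ * X]mxE dE.
  by rewrite normCK mulrAC mulrC.
rewrite -normw mulr_sumr ler_sum // => i _.
by rewrite ler_wpM2r ?exprn_ge0 // lecR.
Qed.

(** * Power sums and hyperbolic cosines *)

(** With [S] the sum, each term is at most [x i * S ^+ l]. The exponent is a successor because a
    zeroth power sum counts its terms. *)
Lemma sum_exp_le_exp_sum (R : realDomainType) (I : finType) (P : pred I)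
    (x : I -> R) (l : nat) :
  (forall i, P i -> 0 <= x i) ->
  \sum_(i | P i) x i ^+ l.+1 <= (\sum_(i | P i) x i) ^+ l.+1.
Proof.
move=> x0; have S0 : 0 <= \sum_(i | P i) x i by apply: sumr_ge0.
rewrite exprS mulr_suml ler_sum // => i Pi; rewrite exprS.
rewrite ler_wpM2l ?x0 // lerXn2r ?nnegrE ?x0 //.
by rewrite (bigD1 i) //= lerDl sumr_ge0 // => j /andP[Pj _]; apply: x0.
Qed.

(** Since [a - x = y - b], this common factor comes out of both [a ^+ l - x ^+ l] and
    [y ^+ l - b ^+ l]; the cofactors compare term by term by [y <= a] and [b <= x]. *)
Lemma exp_spread_le (R : realDomainType) (a b x y : R) (l : nat) :
  0 <= b -> b <= y -> x <= a -> b <= x -> y <= a -> x + y = a + b ->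
  x ^+ l + y ^+ l <= a ^+ l + b ^+ l.
Proof.
move=> b0 hby hxa hbx hya xyab.
have E : a - x = y - b by rewrite -[y](addKr x) xyab addrA addrK addrC.
rewrite -subr_ge0 opprD addrACA.
rewrite -(opprB (y ^+ l)) !subrXX E -mulrBr mulr_ge0 ?subr_ge0 //.
have x0 := le_trans b0 hbx; have y0 := le_trans b0 hby.
apply: ler_sum => i _; rewrite ler_pM ?exprn_ge0 //; apply: lerXn2r.
all: by rewrite ?nnegrE // (le_trans x0).
Qed.

(** If some [x i] exceeds [b], the other entries are merged into one number [y], and the pair
    [(x i, y)] is spread to [(a, b)]. Otherwise every term is at most [x i * b ^+ l], and these add
    up to [(a + b) * b ^+ l]. *)
Lemma sum_exp_majorized (R : realDomainType) (I : finType) (x : I -> R)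
    (a b : R) (l : nat) :
  0 <= b -> b <= a -> (forall i, 0 <= x i <= a) -> \sum_i x i = a + b ->
  \sum_i x i ^+ l.+1 <= a ^+ l.+1 + b ^+ l.+1.
Proof.
move=> b0 ba xa xs; have a0 := le_trans b0 ba.
have x0 i : 0 <= x i by case/andP: (xa i).
have [/existsP[i bxi]|/existsPn xb] := boolP [exists i, b < x i].
  set y := \sum_(j | j != i) x j.
  have xy : x i + y = a + b by rewrite -xs (bigD1 i).
  have xia : x i <= a by case/andP: (xa i).
  rewrite (bigD1 i) //=; apply: le_trans (_ : x i ^+ l.+1 + y ^+ l.+1 <= _).
    by rewrite lerD2l sum_exp_le_exp_sum.
  apply: exp_spread_le; rewrite ?(ltW bxi) //.
    by rewrite -(lerD2l a) -xy lerD2r.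
  by rewrite -(lerD2r b) -xy addrC lerD2r ltW.
apply: (@le_trans _ _ (\sum_i x i * b ^+ l)).
  apply: ler_sum => i _; rewrite exprS ler_wpM2l // lerXn2r ?nnegrE //.
  by rewrite leNgt xb.
by rewrite -mulr_suml xs mulrDl -!exprS lerD2r exprS ler_wpM2l // lerXn2r.
Qed.

Section CoshSqrtSum.
Variables (R : realType) (I : finType).
Implicit Types x y : I -> R.

Definition cosh_sqrt_sum x : R :=
  \sum_i (expR (Num.sqrt (x i)) + expR (- Num.sqrt (x i))).

(** The term of degree [k] in the exponential series of [cosh_sqrt_sum], without its factor
    [1 / k!]: zero for odd [k], twice a power sum of [x] for even [k]. *)
Definition cosh_sqrt_coef x k : R :=
  \sum_i (Num.sqrt (x i) ^+ k + (- Num.sqrt (x i)) ^+ k).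

Lemma cvg_cosh_sqrt_sum x :
  ((fun N => \sum_(k < N) cosh_sqrt_coef x k / k`!%:R) @ \oo -->
   cosh_sqrt_sum x)%classic.
Proof.
have -> : (fun N => \sum_(k < N) cosh_sqrt_coef x k / k`!%:R) =
  (fun N => \sum_i (series (exp_coeff (Num.sqrt (x i))) N +
                    series (exp_coeff (- Num.sqrt (x i))) N)).
  apply/funext => N; rewrite /series /=.
  under [RHS]eq_bigr do rewrite !big_mkord -big_split /=.
  rewrite exchange_big; apply: eq_bigr => k _.
  rewrite /cosh_sqrt_coef mulr_suml.
  by apply: eq_bigr => i _; rewrite /exp_coeff /= mulrDl.
apply: cvg_big => [|i _]; first exact: add_continuous.
apply: cvgD; exact: is_cvg_series_exp_coeff.
Qed.

Lemma cosh_sqrt_coef_odd x k : odd k -> cosh_sqrt_coef x k = 0.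
Proof.
move=> ko; apply: big1 => i _.
by rewrite [(- _) ^+ k]exprNn -signr_odd ko expr1 mulN1r subrr.
Qed.

Lemma cosh_sqrt_coef_double x k : (forall i, 0 <= x i) ->
  cosh_sqrt_coef x k.*2 = (\sum_i x i ^+ k) *+ 2.
Proof.
move=> x0; rewrite -sumrMnl; apply: eq_bigr => i _.
by rewrite -mul2n !exprM sqrrN sqr_sqrtr // mulr2n.
Qed.

Lemma cosh_sqrt_coef_le x y : (forall i, 0 <= x i) -> (forall i, 0 <= y i) ->
  (forall k, \sum_i x i ^+ k <= \sum_i y i ^+ k) ->
  forall k, cosh_sqrt_coef x k <= cosh_sqrt_coef y k.
Proof.
move=> x0 y0 xy k; rewrite -(odd_double_half k).
case: (odd k); last by rewrite !cosh_sqrt_coef_double // lerMn2r xy orbT.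
by rewrite !cosh_sqrt_coef_odd //= odd_double.
Qed.

Lemma cosh_sqrt_sum_le x y : (forall i, 0 <= x i) -> (forall i, 0 <= y i) ->
  (forall k, \sum_i x i ^+ k <= \sum_i y i ^+ k) ->
  cosh_sqrt_sum x <= cosh_sqrt_sum y.
Proof.
move=> x0 y0 xy.
apply: (ler_cvg_to (@cvg_cosh_sqrt_sum x) (@cvg_cosh_sqrt_sum y)).
apply: nearW => N; apply: ler_sum => k _.
by rewrite ler_wpM2r ?invr_ge0 ?ler0n // cosh_sqrt_coef_le.
Qed.

(** The difference of the two series has nonnegative terms and sum zero, so each of its terms
    vanishes; the term of degree [2k] carries the power sum of exponent [k]. *)
Lemma cosh_sqrt_sum_eq x y : (forall i, 0 <= x i) -> (forall i, 0 <= y i) ->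
  (forall k, \sum_i x i ^+ k <= \sum_i y i ^+ k) ->
  cosh_sqrt_sum x = cosh_sqrt_sum y ->
  forall k, \sum_i x i ^+ k = \sum_i y i ^+ k.
Proof.
move=> x0 y0 xy xyE k; apply/eqP; rewrite eq_le xy /=.
have K0 : 0 < (k.*2)`!%:R :> R by rewrite ltr0n fact_gt0.
suff : cosh_sqrt_coef y k.*2 <= cosh_sqrt_coef x k.*2.
  by rewrite !cosh_sqrt_coef_double // lerMn2r.
set d := fun z => cosh_sqrt_coef z k.*2 / (k.*2)`!%:R.
suff : d y - d x <= 0 by rewrite subr_le0 ler_pM2r ?invr_gt0.
have <- : cosh_sqrt_sum y - cosh_sqrt_sum x = 0 by rewrite xyE subrr.
apply: (cvgr_to_ge (cvgB (@cvg_cosh_sqrt_sum y) (@cvg_cosh_sqrt_sum x))).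
exists k.*2.+1 => // N /= kN.
rewrite ?fctE /= -sumrB (bigD1 (Ordinal kN)) //= lerDl sumr_ge0 // => j _.
by rewrite -mulrBl mulr_ge0 ?invr_ge0 ?ler0n // subr_ge0 cosh_sqrt_coef_le.
Qed.
End CoshSqrtSum.

(** * The Estrada index of a bipartite graph *)

(** Passes from distinct eigenvalues with multiplicities to a list of roots with repetitions. *)
Lemma estrada_roots (R : realType) (V : finType) (G : signed_graph V)
    (s : seq R) :
  char_poly (adj_mx R G) = \prod_(z <- s) ('X - z%:P) ->
  estrada R G = \sum_(z <- s) expR z.
Proof.
move=> sE; rewrite /estrada sE.
have -> : [set x | eigenvalue (adj_mx R G) x]%classic = [set` undup s]%classic.
  apply/seteqP; split=> x /=; rewrite mem_undup eigenvalue_root_char sE;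
  by rewrite root_prod_XsubC.
rewrite -fsbig_seq ?undup_uniq //.
under eq_bigr do rewrite mu_prod_XsubC.
rewrite -[RHS](big_undup_iterop_count _ s xpredT expR) /=.
by apply: eq_bigr => z _; rewrite Monoid.iteropE iter_addr addr0.
Qed.

(** Right multiplication by a block triangular matrix of determinant ['X^m] clears the lower left
    block. The powers of ['X] on both sides avoid division and treat all [m], [n] alike. *)
Lemma char_poly_bipartite (F : fieldType) m n (B : 'M[F]_(m, n)) :
  'X^m * char_poly (block_mx 0 B B^T 0) =
  'X^n * (char_poly (B *m B^T) \Po 'X^2).
Proof.
pose C := map_mx polyC B; pose D := map_mx polyC B^T.
have XE : char_poly_mx (block_mx 0 B B^T 0) = block_mx 'X%:M (- C) (- D) 'X%:M.
  rewrite /char_poly_mx map_block_mx !map_mx0 scalar_mx_block opp_block_mx.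
  by rewrite add_block_mx !oppr0 !addr0 !add0r.
have PE : block_mx 'X%:M (- C) (- D) 'X%:M *m block_mx 'X%:M 0 D 1%:M =
   block_mx ('X^2%:M - C *m D) (- C) 0 'X%:M.
  rewrite mulmx_block !mulmx1 !mulmx0 !add0r mulNmx -scalar_mxM -expr2.
  by rewrite mul_mx_scalar mul_scalar_mx scalerN addNr.
have /(congr1 determinant) := PE.
rewrite det_mulmx det_lblock det_ublock !det_scalar expr1n mulr1 -XE.
rewrite -/(char_poly _) mulrC => ->; rewrite [RHS]mulrC; congr (_ * _).
rewrite /char_poly -[RHS]/(comp_poly 'X^2 _).
rewrite -[RHS](det_map_mx (comp_poly 'X^2)); congr (\det _).
apply/matrixP => i j; rewrite !mxE rmorphB rmorphMn /= comp_polyX comp_polyC.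
congr (_ - _); rewrite rmorph_sum; apply: eq_bigr => k _.
by rewrite !mxE rmorphM.
Qed.

Lemma estrada_bipartite (R : realType) (V : finType) (G : signed_graph V)
    m n (B : 'M[R]_(m, n)) (d : 'I_m -> R) :
  char_poly (adj_mx R G) = char_poly (block_mx 0 B B^T 0) ->
  char_poly (B *m B^T) = \prod_i ('X - (d i)%:P) -> (forall i, 0 <= d i) ->
  estrada R G + m%:R =
  n%:R + cosh_sqrt_sum d.
Proof.
move=> GE dE d0.
pose t := flatten [seq [:: Num.sqrt (d i); - Num.sqrt (d i)] | i <- enum 'I_m].
have XnE k : 'X^k = \prod_(z <- nseq k 0) ('X - z%:P) :> {poly R}.
  by rewrite big_nseq subr0 iter_mulr_1.
have tE : char_poly (B *m B^T) \Po 'X^2 = \prod_(z <- t) ('X - z%:P).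
  rewrite dE rmorph_prod /t big_flatten big_map big_enum /=.
  apply: eq_bigr => i _; rewrite !big_cons big_nil mulr1.
  rewrite /= comp_polyB comp_polyX comp_polyC -{1}(sqr_sqrtr (d0 i)) rmorphXn.
  by rewrite subr_sqr polyCN opprK.
have := char_poly_bipartite B; rewrite tE !XnE -big_cat -GE /= => E.
(* A monic divisor of a product of linear factors is the product of a sublist, so the characteristic
   polynomial splits over [R]. Both sides of [E] then list the same roots. *)
have /dvdp_prod_XsubC [k] : char_poly (adj_mx R G) %| 
    \prod_(z <- nseq n 0 ++ t) ('X - z%:P).
  by rewrite -E dvdp_mulIr.
rewrite eqp_monic ?char_poly_monic ?monic_prod_XsubC // => /eqP sE.
rewrite (estrada_roots sE); move: E; rewrite sE -big_cat /=.
move=> /prod_XsubC_eq pE.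
have : \sum_(z <- nseq m 0 ++ mask k (nseq n 0 ++ t)) expR z =
       \sum_(z <- nseq n 0 ++ t) expR z by apply: perm_big.
rewrite !big_cat /= !big_nseq.
have iterE l : iter l (+%R (expR 0)) 0 = l%:R :> R.
  by rewrite expR0 iter_addr addr0.
rewrite !iterE addrC => ->; congr (_ + _).
rewrite /t big_flatten big_map big_enum; apply: eq_bigr => i _.
by rewrite !big_cons big_nil /= addr0.
Qed.

(** * Spectra of Gram matrices of sign matrices *)

Definition sign_mx (R : realType) m n (B : 'M[R]_(m, n)) : Prop :=
  forall i j, B i j ^+ 2 = 1.

(** The matrix form of balance: switching by [s] and [t] makes every entry 1. *)
Definition sign_rank1 (R : realType) m n (B : 'M[R]_(m, n)) : Prop :=
  exists (s : 'I_m -> R) (t : 'I_n -> R),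
    [/\ forall i, s i ^+ 2 = 1, forall j, t j ^+ 2 = 1
      & forall i j, B i j = s i * t j].

Definition one_neg (R : realType) m n (i0 : 'I_m) (j0 : 'I_n) : 'M[R]_(m, n) :=
  \matrix_(i, j) if (i == i0) && (j == j0) then -1 else 1.

Lemma one_neg_sign (R : realType) m n (i0 : 'I_m) (j0 : 'I_n) :
  sign_mx (one_neg R i0 j0).
Proof. by move=> i j; rewrite mxE; case: ifP; rewrite ?sqrrN expr1n. Qed.

Lemma row_normE (R : realType) n (v : 'rV[R]_n) :
  (v *m v^T) 0 0 = \sum_j v 0 j ^+ 2.
Proof. by rewrite mxE; apply: eq_bigr => j _; rewrite !mxE expr2. Qed.

Lemma row_norm_gt0 (R : realType) n (v : 'rV[R]_n) :
  v != 0 -> 0 < (v *m v^T) 0 0.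
Proof.
move=> /rV0Pn[j vj]; rewrite row_normE (bigD1 j) //=.
by rewrite ltr_pwDl ?exprn_even_gt0 // sumr_ge0 // => k _; rewrite sqr_ge0.
Qed.

Lemma gram_formE (R : realType) m n (B : 'M[R]_(m, n)) (u : 'rV_m) :
  (u *m (B *m B^T) *m u^T) 0 0 = \sum_j (\sum_i u 0 i * B i j) ^+ 2.
Proof.
have -> : u *m (B *m B^T) *m u^T = (u *m B) *m (u *m B)^T.
  by rewrite trmx_mul !mulmxA.
by rewrite row_normE; apply: eq_bigr => j _; rewrite mxE.
Qed.

(** Transposing two rows and two columns moves the negative entry and preserves both sums of
    squares. *)
Lemma one_neg_form (R : realType) m n (i0 i1 : 'I_m) (j0 j1 : 'I_n) (a : R) :
  (forall u : 'rV_m,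
     \sum_j (\sum_i u 0 i * one_neg R i1 j1 i j) ^+ 2 <=
     a * \sum_i u 0 i ^+ 2) ->
  forall u : 'rV_m,
     \sum_j (\sum_i u 0 i * one_neg R i0 j0 i j) ^+ 2 <=
     a * \sum_i u 0 i ^+ 2.
Proof.
move=> ha u; have := ha (\row_i u 0 (tperm i0 i1 i)).
rewrite (reindex_inj (@perm_inj _ (tperm j0 j1))) /=.
rewrite [X in _ <= _ * X](reindex_inj (@perm_inj _ (tperm i0 i1))) /=.
under [X in _ <= _ * X]eq_bigr do rewrite mxE tpermK.
congr (_ <= _); apply: eq_bigr => j _; congr (_ ^+ 2).
rewrite (reindex_inj (@perm_inj _ (tperm i0 i1))) /=.
apply: eq_bigr => i _; rewrite !mxE tpermK; congr (_ * _).
by rewrite !(can2_eq (tpermK _ _) (tpermK _ _)) !tpermR.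
Qed.

(* Replacing the entries of [u] and [u *m B] by their absolute values turns [B]
   into a sign matrix with some negative entry, hence entrywise below a matrix
   with exactly one negative entry. *)
Lemma gram_form_le (R : realType) m n (B : 'M[R]_(m, n)) (i1 : 'I_m) (j1 : 'I_n)
    (a : R) :
  sign_mx B -> ~ sign_rank1 B ->
  (forall u : 'rV_m,
     \sum_j (\sum_i u 0 i * one_neg R i1 j1 i j) ^+ 2 <=
     a * \sum_i u 0 i ^+ 2) ->
  forall u : 'rV_m,
     \sum_j (\sum_i u 0 i * B i j) ^+ 2 <= a * \sum_i u 0 i ^+ 2.
Proof.
move=> Bs Bn1 ha u; pose v j := \sum_i u 0 i * B i j.
pose s (x : R) : R := if x < 0 then -1 else 1.
have s2 x : s x ^+ 2 = 1 by rewrite /s; case: ifP; rewrite ?sqrrN expr1n.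
have sM x : x = s x * `|x|.
  rewrite /s; case: ltP => x0; last by rewrite mul1r ger0_norm.
  by rewrite ltr0_norm // mulN1r opprK.
(* [C] is [B] switched by the signs of [u] and of [v]; if it had no entry other than 1, then [B]
   would be the product of these signs. *)
pose C i j := s (u 0 i) * s (v j) * B i j.
have C2 i j : C i j ^+ 2 = 1 by rewrite !exprMn Bs !s2 !mulr1.
have [i0 [j0 Cij]] : exists i0 j0, C i0 j0 != 1.
  apply: contra_notP Bn1 => nC.
  exists (fun i => s (u 0 i)), (fun j => s (v j)); split=> // i j.
  have Cij : C i j = 1.
    by apply/eqP; apply: contra_notT nC => ?; exists i, j.
  by rewrite -[RHS]mulr1 -[in RHS]Cij /C mulrA -expr2 exprMn !s2 !mul1r.
have Cle i j : C i j <= one_neg R i0 j0 i j.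
  rewrite mxE; have /eqP := C2 i j; rewrite sqrf_eq1.
  case: ifP => [/andP[/eqP -> /eqP ->]|_].
    by rewrite (negbTE Cij) /= => /eqP ->.
  by case/orP => /eqP ->; lra.
pose w j := \sum_i `|u 0 i| * one_neg R i0 j0 i j.
have vw j : v j ^+ 2 <= `|v j| * w j.
  rewrite expr2 {1}(sM (v j)) mulrAC mulrC ler_wpM2l // mulr_sumr.
  apply: ler_sum => i _; apply: le_trans (_ : `|u 0 i| * C i j <= _).
    by rewrite {1}(sM (u 0 i)) le_eqVlt /C; apply/orP; left; apply/eqP; ring.
  by rewrite ler_wpM2l.
have vlew : \sum_j v j ^+ 2 <= \sum_j w j ^+ 2.
  rewrite -subr_ge0 -sumrB.
  (* By [vw], the square of [w j - |v j|] is at most [w j ^+ 2 - v j ^+ 2], whatever the sign of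
     [w j]. *)
  apply: (@le_trans _ _ (\sum_j (w j - `|v j|) ^+ 2)).
    by rewrite sumr_ge0 // => j _; rewrite sqr_ge0.
  apply: ler_sum => j _; rewrite sqrrB real_normK ?num_real //.
  by have := vw j; lra.
have := @one_neg_form R m n i0 i1 j0 j1 a ha (\row_i `|u 0 i|).
under [X in X <= _]eq_bigr do under eq_bigr do rewrite mxE.
under [X in _ <= a * X]eq_bigr do rewrite mxE real_normK ?num_real //.
exact: le_trans.
Qed.

(** The matrix is the all-ones matrix minus twice a matrix unit. *)
Lemma rank_one_neg (R : realType) m n (i0 : 'I_m) (j0 : 'I_n) :
  (\rank (one_neg R i0 j0) <= 2)%N.
Proof.
have -> : one_neg R i0 j0 =
    (const_mx 1 : 'cV_m) *m (const_mx 1 : 'rV_n) +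
    (- 2 *: delta_mx i0 0 : 'cV_m) *m (delta_mx 0 j0 : 'rV_n).
  apply/matrixP => i j; rewrite !mxE !big_ord1 !mxE !eqxx mulr1 andbT.
  by case: eqP; case: eqP => /= _ _; ring.
apply: (leq_trans (mxrank_add _ _)); rewrite (leq_add (n1 := 1) (n2 := 1)) //.
  by rewrite (leq_trans (mxrankM_maxl _ _)) ?rank_leq_col.
by rewrite (leq_trans (mxrankM_maxl _ _)) ?rank_leq_col.
Qed.

Lemma root_char_poly_form (R : realType) m (M : 'M[R]_m) (x : R) :
  root (char_poly M) x ->
  exists2 u : 'rV_m, 0 < (u *m u^T) 0 0 &
    (u *m M *m u^T) 0 0 = x * (u *m u^T) 0 0.
Proof.
rewrite -eigenvalue_root_char => /eigenvalueP[u uM u0]; exists u.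
  exact: row_norm_gt0.
by rewrite uM -scalemxAl mxE.
Qed.

Lemma gram_trace (R : realType) m n (B : 'M[R]_(m, n)) :
  sign_mx B -> \tr (B *m B^T) = (m * n)%:R.
Proof.
move=> Bs; rewrite /mxtrace.
have E i : (B *m B^T) i i = n%:R.
  rewrite mxE (eq_bigr (fun=> 1)) ?sumr_const ?card_ord // => j _.
  by rewrite mxE -expr2 Bs.
rewrite (eq_bigr _ (fun i _ => E i)) sumr_const card_ord.
by rewrite mulnC natrM mulr_natr.
Qed.

Lemma gram_trace2 (R : realType) m n (B : 'M[R]_(m, n)) :
  \tr ((B *m B^T) *m (B *m B^T)) = \sum_i \sum_k (\sum_j B i j * B k j) ^+ 2.
Proof.
rewrite /mxtrace; apply: eq_bigr => i _; rewrite mxE; apply: eq_bigr => k _.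
rewrite expr2 !mxE; congr (_ * _); apply: eq_bigr => j _; rewrite !mxE //.
by rewrite mulrC.
Qed.

(** [a] is the maximum, which exists because [i] inhabits the index type; [b] is the other nonzero
    value, or 0. Successor exponents make the zero entries disappear. *)
Lemma sum_exp_two_nonzero (R : realDomainType) m (d : 'I_m -> R) (i : 'I_m) :
  (forall k, 0 <= d k) -> (#|[pred k | d k != 0%R]| <= 2)%N ->
  exists a b, [/\ 0 <= b, b <= a, forall k, d k <= a
    & forall l, \sum_k d k ^+ l.+1 = a ^+ l.+1 + b ^+ l.+1].
Proof.
move=> d0 d2; pose k0 := [arg max_(k > i) d k]%O; exists (d k0).
have dk0 k : d k <= d k0.
  by rewrite /k0; case: arg_maxP => // j _; apply.
have [/existsP[k1 /andP[k10 dk1]]|/existsPn nk] :=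
  boolP [exists k, (k != k0) && (d k != 0)]; last first.
  exists 0; split=> //.
  move=> l; rewrite (bigD1 k0) //= big1 ?expr0n // => k kk0.
  by have := nk k; rewrite kk0 negbK /= => /eqP ->; rewrite expr0n.
exists (d k1); split=> //.
move=> l; rewrite (bigD1 k0) //= (bigD1 k1) //= big1 ?addr0 //.
move=> k /andP[kk0 kk1].
have [->|dk] := eqVneq (d k) 0; first by rewrite expr0n.
have dk0n : d k0 != 0.
  by rewrite gt_eqF // (lt_le_trans _ (dk0 k1)) // lt_neqAle eq_sym dk1 d0.
have : (3 <= #|[pred k | d k != 0%R]|)%N.
  rewrite -(_ : #|k |: [set k0; k1]| = 3%N).
    apply: subset_leq_card; apply/fintype.subsetP => j.
    by rewrite !inE => /or3P[] /eqP ->.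
  by rewrite cardsU1 cards2 !inE negb_or kk0 kk1 eq_sym k10.
by rewrite leqNgt ltnS d2.
Qed.

(** The largest eigenvalue [a] for [C] bounds its quadratic form, hence that of [B], hence every
    [d i]. As the two traces agree, majorization applies. *)
Lemma gram_spectrum (R : realType) m n (B : 'M[R]_(m, n))
    (i1 : 'I_m) (j1 : 'I_n) :
  sign_mx B -> ~ sign_rank1 B ->
  let C := one_neg R i1 j1 in
  exists d e : 'I_m -> R,
  [/\ char_poly (B *m B^T) = \prod_i ('X - (d i)%:P)
       /\ char_poly (C *m C^T) = \prod_i ('X - (e i)%:P),
      forall i, 0 <= d i, forall i, 0 <= e i,
      forall k, \sum_i d i ^+ k <= \sum_i e i ^+ k &
      \sum_i d i ^+ 2 = \sum_i e i ^+ 2 ->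
      \tr ((B *m B^T) *m (B *m B^T)) = \tr ((C *m C^T) *m (C *m C^T))].
Proof.
move=> Bs Bn1 C.
have sym (A : 'M[R]_(m, n)) : (A *m A^T)^T = A *m A^T by rewrite trmx_mul trmxK.
have [d [dE dtr dtr2 _ _]] := symmetric_spectral (sym B).
have [e [eE etr etr2 erk eform]] := symmetric_spectral (sym C).
have ge0 (A : 'M[R]_(m, n)) (f : 'I_m -> R) :
    char_poly (A *m A^T) = \prod_i ('X - (f i)%:P) -> forall i, 0 <= f i.
  move=> fE i; have : root (char_poly (A *m A^T)) (f i).
    by rewrite fE (bigD1 i) //= rootM root_XsubC eqxx.
  move=> /root_char_poly_form[u u0 /eqP]; rewrite gram_formE => /eqP uE.
  rewrite -(pmulr_lge0 _ u0) -uE sumr_ge0 // => j _; exact: sqr_ge0.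
have d0 := ge0 _ _ dE; have e0 := ge0 _ _ eE.
exists d, e; split=> //; last by rewrite dtr2 etr2.
have [a [b [b0 ba ea eab]]] := sum_exp_two_nonzero i1 e0
  (leq_trans erk (leq_trans (mxrankM_maxl _ _) (rank_one_neg _ _ _))).
have da i : d i <= a.
  have : root (char_poly (B *m B^T)) (d i).
    by rewrite dE (bigD1 i) //= rootM root_XsubC eqxx.
  move=> /root_char_poly_form[u u0]; rewrite gram_formE => uE.
  rewrite -(ler_pM2r u0) -uE row_normE; apply: gram_form_le => // v.
  by rewrite -row_normE -gram_formE; apply: eform.
(* For exponent 0 both sums count the indices. *)
case=> [|k]; first exact: lexx.
rewrite eab sum_exp_majorized // => [i|]; first by rewrite d0 da.
have := eab 0%N; rewrite !expr1 => <-; under [RHS]eq_bigr do rewrite expr1.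
by rewrite -dtr -etr !gram_trace //; apply: one_neg_sign.
Qed.

(** * Sign matrices of minimal weight *)

(** [p] and [q] are the sizes of two blocks of rows, [a] the weight between them, [b] and [c] the
    weights inside. As [p * q = (p + q - 1) + (p - 1) * (q - 1)], the upper bound forces
    [(p - 1) * (q - 1) = 0] and leaves no slack. *)
Lemma extremal_arith (m n p q a b c : nat) :
  (0 < p)%N -> (0 < q)%N -> (1 < n)%N -> (p + q = m)%N ->
  (p * (q * n.-1) <= a)%N -> (b + a + (a + c) <= 2 * (m.-1 * n.-1))%N ->
  [/\ (p * (q * n.-1))%N = a, c = 0%N & p = 1%N \/ q = 1%N].
Proof.
case: p q n => [//|p] [//|q] [//|[//|n]] _ _ _ <- /= h1 h2.
have E : (p.+1 * (q.+1 * n.+1) = (p + q.+1) * n.+1 + p * q * n.+1)%N by lia.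
have pq0 : (p * q * n.+1 = 0)%N by lia.
have : (p * q = 0)%N by move/eqP: pq0; rewrite muln_eq0 orbF => /eqP.
by move=> /eqP; rewrite muln_eq0 => pq; split; lia.
Qed.

Section Rows.
Variables (R : realType) (m n : nat) (B : 'M[R]_(m, n)).
Hypothesis Bs : sign_mx B.

Definition row_diff i k : nat := #|[pred j | B i j != B k j]|.

(* The number of negative 4-cycles through rows [i] and [k]. *)
Definition row_weight i k : nat := (row_diff i k * (n - row_diff i k))%N.

Definition row_par i k : bool :=
  [forall j, B i j == B k j] || [forall j, B i j == - B k j].

Lemma sign_cases i j k : B i j = B k j \/ B i j = - B k j.
Proof.
have /eqP : B i j ^+ 2 = B k j ^+ 2 by rewrite !Bs.
by rewrite eqf_sqr => /orP[] /eqP; [left | right].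
Qed.

Lemma row_diff_le i k : (row_diff i k <= n)%N.
Proof. by rewrite -[X in (_ <= X)%N]card_ord max_card. Qed.

Lemma row_diffC i k : row_diff i k = row_diff k i.
Proof. by apply: eq_card => j; rewrite !inE eq_sym. Qed.

(** With [d] differing places the inner product of the rows is [n - 2d], whose square is
    [n^2 - 4d(n - d)]. *)
Lemma gram_entry_sqr i k :
  (\sum_j B i j * B k j) ^+ 2 = n%:R ^+ 2 - 4 * (row_weight i k)%:R.
Proof.
have -> : \sum_j B i j * B k j = n%:R - 2 * (row_diff i k)%:R.
  have nE : n%:R = \sum_(j < n) 1 :> R by rewrite sumr_const card_ord.
  rewrite /row_diff -sum1_card natr_sum mulr_sumr nE [X in _ - X]big_mkcond /=.
  rewrite -sumrB; apply: eq_bigr => j _; rewrite inE.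
  case: eqVneq => [->|]; first by rewrite -expr2 Bs subr0.
  move=> neq; have -> : B i j = - B k j.
    by case: (sign_cases i j k) => // E; rewrite E eqxx in neq.
  by rewrite mulNr -expr2 Bs /=; ring.
rewrite /row_weight natrM natrB ?row_diff_le //; ring.
Qed.

Lemma row_par_sign i k : row_par i k ->
  exists2 c : R, c ^+ 2 = 1 & forall j, B i j = c * B k j.
Proof.
case/orP => /forallP h; [exists 1 | exists (-1)];
  rewrite ?sqrrN ?expr1n // => j; by rewrite (eqP (h j)) ?mulN1r ?mul1r.
Qed.

Lemma sign_row_par i k (c : R) :
  c ^+ 2 = 1 -> (forall j, B i j = c * B k j) -> row_par i k.
Proof.
move=> /eqP; rewrite sqrf_eq1 => /orP[] /eqP -> h; apply/orP; [left|right];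
by apply/forallP => j; rewrite h ?mulN1r ?mul1r.
Qed.

Lemma row_par_trans i k l : row_par i l -> row_par k l -> row_par i k.
Proof.
move=> /row_par_sign[c c1 ic] /row_par_sign[d d1 kd].
apply: (@sign_row_par _ _ (c * d)) => [|j]; first by rewrite exprMn c1 d1 mulr1.
by rewrite ic kd mulrA -(mulrA c) -expr2 d1 mulr1.
Qed.

Lemma row_par_refl i : row_par i i.
Proof. by apply/orP; left; apply/forallP. Qed.

Lemma row_diff_bounds i k : ~~ row_par i k -> (0 < row_diff i k < n)%N.
Proof.
rewrite negb_or => /andP[/forallPn[j ij] /forallPn[l il]]; apply/andP; split.
  by apply/card_gt0P; exists j.
rewrite -[X in (_ < X)%N]card_ord; apply: proper_card.
apply/properP; split; first exact/fintype.subsetP.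
exists l => //; rewrite inE negbK; case: (sign_cases i l k) => [->//|E].
by rewrite E eqxx in il.
Qed.

Lemma row_weight0_par i k : row_weight i k = 0%N -> row_par i k.
Proof.
move=> w0; apply: contraT => /row_diff_bounds.
by move: w0; rewrite /row_weight; nia.
Qed.

(** For [0 < d < n] one has [d(n - d) - (n - 1) = (d - 1)(n - 1 - d) >= 0], with equality only at
    the two ends. *)
Lemma row_weight_ge i k : ~~ row_par i k -> (n.-1 <= row_weight i k)%N.
Proof. by move=> /row_diff_bounds; rewrite /row_weight; nia. Qed.

Lemma row_weight_min i k : ~~ row_par i k -> row_weight i k = n.-1 ->
  row_diff i k = 1%N \/ row_diff i k = n.-1.
Proof.
move=> /row_diff_bounds /andP[]; rewrite /row_weight.
by case: (row_diff i k) => [//|[|d]]; [left|right; nia].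
Qed.

(* Up to the sign of row [k], it differs from row [r] in exactly one place. *)
Lemma one_neg_of_rows k r :
  (forall i, i != k -> row_par i r) ->
  ~~ row_par k r -> row_weight k r = n.-1 ->
  exists (j0 : 'I_n) (s : 'I_m -> R) (t : 'I_n -> R),
    [/\ forall i, s i ^+ 2 = 1, forall j, t j ^+ 2 = 1
      & forall i j, B i j = s i * t j * one_neg R k j0 i j].
Proof.
move=> par_r npar wmin.
have [c [j0 [c2 kr kj0]]] : exists (c : R) j0,
    [/\ c ^+ 2 = 1, forall j, j != j0 -> B k j = c * B r j
      & B k j0 = - (c * B r j0)].
  (* Either the rows differ only at [j0], and [c = 1], or they agree only at [j0], and [c = -1]. *)
  have [] := row_weight_min npar wmin.
    move=> /mem_card1[j0 hj0]; exists 1, j0; split; first by rewrite expr1n.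
      by move=> j; have := hj0 j; rewrite !inE mul1r => + /negbTE jj0;
        rewrite jj0 => /negbFE/eqP.
    have := hj0 j0; rewrite !inE eqxx mul1r.
    by case: (sign_cases k j0 r) => [->|//]; rewrite eqxx.
  move=> dn; have [d0 dltn] := andP (row_diff_bounds npar).
  have /mem_card1[j0 hj0] : #|[predC [pred j | B k j != B r j]]| = 1%N.
    apply/eqP; rewrite -(eqn_add2l (row_diff k r)) cardC card_ord dn.
    by rewrite addn1 prednK ?(leq_trans _ dltn).
  exists (-1), j0; split; first by rewrite sqrrN expr1n.
    move=> j; have := hj0 j; rewrite !inE negbK mulN1r => + /negbTE jj0.
    rewrite jj0; case: (sign_cases k j r) => -> //.
      by rewrite eqxx.
  by have := hj0 j0; rewrite !inE eqxx negbK mulN1r opprK => /eqP.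
(* The premise sits under the existential so that choice yields a total function; its value at [k]
   is a placeholder, replaced by [c] below. *)
have cs i : exists c : R, i != k -> c ^+ 2 = 1 /\ forall j, B i j = c * B r j.
  have [->|/par_r/row_par_sign[d d1 id]] := eqVneq i k; first by exists 0.
  by exists d => _.
have [s hs] := boolp.choice cs.
exists j0, (fun i => if i == k then c else s i), (B r); split=> // i.
- by case: eqVneq => // /hs[].
- move=> j; rewrite mxE; case: eqVneq => [->|ik] /=; last first.
    by rewrite mulr1; case: (hs i ik) => _ ->.
  case: eqVneq => [->|jj0]; first by rewrite kj0 mulrN1.
    by rewrite mulr1 kr.
Qed.


Lemma row_parC i k : row_par i k = row_par k i.
Proof.
rewrite /row_par; congr (_ || _); apply: eq_forallb => j; first exact: eq_sym.
by rewrite [RHS]eq_sym eqr_oppLR.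
Qed.

Lemma row_weightC i k : row_weight i k = row_weight k i.
Proof. by rewrite /row_weight row_diffC. Qed.

(** The double sum runs over ordered pairs of rows, so it counts each negative 4-cycle twice. *)
Lemma gram_trace2_weight :
  \tr ((B *m B^T) *m (B *m B^T)) =
  m%:R * (m%:R * n%:R ^+ 2) - 4 * (\sum_i \sum_k row_weight i k)%N%:R.
Proof.
rewrite gram_trace2.
have E i : \sum_k (\sum_j B i j * B k j) ^+ 2 =
           m%:R * n%:R ^+ 2 - 4 * (\sum_k row_weight i k)%N%:R.
  rewrite (eq_bigr _ (fun k _ => gram_entry_sqr i k)).
  by rewrite sumrB sumr_const card_ord -[_ *+ m]mulr_natl natr_sum mulr_sumr.
rewrite (eq_bigr _ (fun i _ => E i)).
by rewrite sumrB sumr_const card_ord -[_ *+ m]mulr_natl natr_sum mulr_sumr.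
Qed.

(* If [P] and its complement [Q] are unions of classes of parallel rows, then the
   weight is at least [2 |P| |Q| (n - 1)], while [|P| |Q| >= |P| + |Q| - 1]. *)
Lemma weight_extremal :
  ~ sign_rank1 B ->
  (\sum_i \sum_k row_weight i k <= 2 * (m.-1 * n.-1))%N ->
  exists i0 j0 (s : 'I_m -> R) (t : 'I_n -> R),
    [/\ forall i, s i ^+ 2 = 1, forall j, t j ^+ 2 = 1
      & forall i j, B i j = s i * t j * one_neg R i0 j0 i j].
Proof.
move=> Bn1 wle.
(* A matrix without rows is vacuously of the form [s i * t j]. *)
have [m0|[i0 _]] : m = 0%N \/ exists i : 'I_m, True.
    by case: (m) => [|k]; [left | right; exists ord0].
  case: Bn1; exists (fun=> 1), (fun=> 1).
  by split=> [i|j|i]; rewrite ?expr1n //; exfalso; have := ltn_ord i; lia.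
have [q0 Qq0] : exists q, ~~ row_par q i0.
  apply: contra_notP Bn1 => npar.
  have cs i : exists c : R, c ^+ 2 = 1 /\ forall j, B i j = c * B i0 j.
    have /row_par_sign[c c1 ci] : row_par i i0.
      by apply: contra_notT npar => ?; exists i.
    by exists c.
  have [s hs] := boolp.choice cs.
  by exists s, (B i0); split=> [i||i]; [case: (hs i)| |case: (hs i)].
(* [P] is the parallel class of [i0]; [Q] is nonempty because it contains [q0]. *)
pose P := [set i | row_par i i0]; pose Q := ~: P.
have Pi0 : i0 \in P by rewrite inE row_par_refl.
have Qq : q0 \in Q by rewrite !inE.
have PQ i k : i \in P -> k \in Q -> ~~ row_par i k.
  rewrite !inE => Pi; apply: contra => ik.
  by apply: (@row_par_trans k i0 i); rewrite row_parC.
have pq : (#|P| + #|Q| = m)%N by rewrite cardsC card_ord.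
have p0 : (0 < #|P|)%N by apply/card_gt0P; exists i0.
have q0' : (0 < #|Q|)%N by apply/card_gt0P; exists q0.
have n2 : (1 < n)%N.
  by have /andP[] := row_diff_bounds (PQ _ _ Pi0 Qq); lia.
pose A := (\sum_(i in P) \sum_(k in Q) row_weight i k)%N.
pose D := (\sum_(i in Q) \sum_(k in Q) row_weight i k)%N.
have TE : (\sum_i \sum_k row_weight i k)%N =
    ((\sum_(i in P) \sum_(k in P) row_weight i k) + A + (A + D))%N.
  rewrite (bigID (mem P)) /=; congr (_ + _)%N.
    rewrite /A -big_split; apply: eq_bigr => i _ /=.
    rewrite (bigID (mem P)) /=; congr (_ + _)%N.
    by apply: eq_bigl => k; rewrite !inE.
  rewrite /A /D [in RHS]exchange_big -big_split /=.
  apply: eq_big => [k|i _]; first by rewrite !inE.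
  rewrite (bigID (mem P)) /=; congr (_ + _)%N.
    by apply: eq_bigr => k _; rewrite row_weightC.
  by apply: eq_bigl => k; rewrite !inE.
(* The equality condition is kept: it will give every cross pair the exact weight [n.-1]. *)
have AP : (#|P| * (#|Q| * n.-1) <= A ?= iff
    [forall (i | i \in P), [forall (k | k \in Q), n.-1 == row_weight i k]])%N.
  rewrite -sum_nat_const; apply: leqif_sum => i Pi.
  rewrite -sum_nat_const; apply: leqif_sum => k Qk.
  by apply: leqif_eq; rewrite row_weight_ge // PQ.
have [AP1 AP2] := AP; rewrite TE in wle.
have [AE D0 pq1] := extremal_arith p0 q0' n2 pq AP1 wle.
have wPQ i k : i \in P -> k \in Q -> row_weight i k = n.-1.
  move=> Pi Qk; move/eqP: AE; rewrite AP2 => /forall_inP/(_ _ Pi)/forall_inP.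
  by move=> /(_ _ Qk)/eqP.
have QQ i k : i \in Q -> k \in Q -> row_par i k.
  move=> Qi Qk; apply: row_weight0_par; move/eqP: D0.
  rewrite sum_nat_eq0 => /forall_inP/(_ _ Qi).
  by rewrite sum_nat_eq0 => /forall_inP/(_ _ Qk)/eqP.
(* The row of the singleton block is the exceptional one. The remaining rows are mutually parallel:
   in [Q] because its inner weight is zero, in [P] by definition. *)
case: pq1 => [/eqP/cards1P[p PE]|/eqP/cards1P[q QE]].
- exists i0; apply: (@one_neg_of_rows _ q0); rewrite ?PQ ?wPQ // => i ii0.
  apply: QQ => //; rewrite inE PE inE.
  by move: Pi0 ii0; rewrite PE inE => /eqP ->.
- exists q0; apply: (@one_neg_of_rows _ i0) => [i iq0||].
    have : i \notin Q.
      by rewrite QE inE; move: Qq iq0; rewrite QE inE => /eqP ->.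
    by rewrite !inE negbK.
  - by rewrite row_parC PQ.
  - by rewrite row_weightC wPQ.
Qed.
End Rows.

(** Row [i0] differs from each other row in column [j0] alone, and the other rows coincide. *)
Lemma row_weight_one_neg (R : realType) m n (i0 : 'I_m) (j0 : 'I_n) i k :
  row_weight (one_neg R i0 j0) i k =
  (if (i == i0) (+) (k == i0) then n.-1 else 0)%N.
Proof.
have n0 : (0 < n)%N := leq_ltn_trans (leq0n _) (ltn_ord j0).
have N1 : (-1 == 1 :> R) = false.
  by apply/negbTE; rewrite lt_eqF // (lt_trans (ltrN10 _)) ?ltr01.
have -> : row_weight (one_neg R i0 j0) i k =
   let d := #|[pred j | ((i == i0) (+) (k == i0)) && (j == j0)]| in
    (d * (n - d))%N.
  rewrite /row_weight /row_diff /=; set x := #|_|; set y := #|_|.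
  suff -> : x = y by [].
  apply: eq_card => j; rewrite !inE !mxE.
  by case: (i == i0); case: (k == i0); case: (j == j0);
    rewrite /= ?eqxx ?N1 // eq_sym N1.
case: ((i == i0) (+) (k == i0)) => /=.
  rewrite (_ : #|_| = 1%N) ?mul1n ?subn1 // -(card1 j0).
  exact: eq_card.
by rewrite (_ : #|_| = 0%N) ?mul0n // -(@card0 'I_n); apply: eq_card.
Qed.

Lemma weight_one_neg (R : realType) m n (i0 : 'I_m) (j0 : 'I_n) :
  (\sum_i \sum_k row_weight (one_neg R i0 j0) i k = 2 * (m.-1 * n.-1))%N.
Proof.
under eq_bigr do under eq_bigr do rewrite row_weight_one_neg.
rewrite (bigD1 i0) //= eqxx /=.
rewrite -big_mkcond /= sum_nat_const.
under eq_bigr => i ii0.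
  rewrite (negbTE ii0) /= -big_mkcond /= big_pred1_eq; over.
rewrite sum_nat_const.
have -> : #|[pred i | i != i0]| = m.-1.
  by rewrite -[m in RHS]card_ord -(cardC1 i0); apply: eq_card.
by rewrite mul2n addnn.
Qed.

(** * Biadjacency matrices of signed complete bipartite graphs *)

(** Conjugation by a signed permutation matrix covers relabelling and switching at once. Two sizes
    are allowed because [#|V|] and [m + n] are equal without being convertible. *)
Lemma char_poly_signed_bij (F : fieldType) n n' (h : 'I_n -> 'I_n')
    (A : 'M[F]_n) (A' : 'M[F]_n') (z : 'I_n -> F) :
  bijective h -> (forall i, z i ^+ 2 = 1) ->
  (forall i j, A' (h i) (h j) = z i * z j * A i j) ->
  char_poly A = char_poly A'.
Proof.
move=> hb z2 hA; have nn' : n = n'.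
  by rewrite -(card_ord n) -(card_ord n') (bij_eq_card hb).
case: _ / nn' in h A' hb hA *; have hi := bij_inj hb.
pose P : 'M[F]_n := \matrix_(k, i) if k == h i then z i else 0.
have hP i : P (h i) i = z i by rewrite mxE eqxx.
have hP0 i j : i != j -> P (h i) j = 0 by rewrite mxE (inj_eq hi) => /negbTE ->.
have Pu : P \in unitmx.
  suff /mulmx1_unit[] : P^T *m P = 1%:M by [].
  apply/matrixP => i j; rewrite !mxE (reindex h) /=; last exact: onW_bij.
  rewrite (bigD1 i) //= big1 ?addr0 => [|k ki]; last by rewrite mxE hP0 ?mul0r.
  rewrite mxE hP; have [<-|ij] := eqVneq i j; first by rewrite hP -expr2 z2.
  by rewrite hP0 // mulr0.
apply: (char_poly_similar Pu); apply/matrixP => k j.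
have [h' _ h'K] := hb; rewrite -[k]h'K; move: (h' k) => i {k}.
rewrite !mxE (bigD1 i) //= big1 ?addr0 => [|k ki]; last first.
  by rewrite hP0 ?mul0r // eq_sym.
rewrite [RHS](reindex h) /=; last exact: onW_bij.
rewrite [RHS](bigD1 j) //= [X in _ + X]big1 ?addr0 => [|k kj]; last first.
  by rewrite hP0 ?mulr0.
by rewrite !hP hA -[LHS]mulr1 -(z2 j); ring.
Qed.

Lemma estrada_char_poly (R : realType) (V W : finType) (G : signed_graph V)
    (H : signed_graph W) :
  char_poly (adj_mx R G) = char_poly (adj_mx R H) -> estrada R G = estrada R H.
Proof.
move=> GH; rewrite /estrada GH.
suff -> : [set x | eigenvalue (adj_mx R G) x]%classic =
          [set x | eigenvalue (adj_mx R H) x]%classic by [].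
by apply/seteqP; split=> x /=; rewrite !eigenvalue_root_char GH.
Qed.

Lemma switching_equivalent_estrada (R : realType) (V W : finType)
    (G : signed_graph V) (H : signed_graph W) :
  switching_equivalent G H -> estrada R G = estrada R H.
Proof.
move=> [Z [f [fb fe fs]]]; apply: estrada_char_poly.
pose s (u : V) : R := if u \in Z then -1 else 1.
apply: (@char_poly_signed_bij _ _ _ (fun i => enum_rank (f (enum_val i))) _ _
  (fun i => s (enum_val i))).
- by apply: bij_comp (enum_rank_bij _) (bij_comp fb (enum_val_bij _)).
- by move=> i; rewrite /s; case: ifP; rewrite ?sqrrN expr1n.
move=> i j; rewrite !mxE !enum_rankK fe /=.
case: ifP => [uv|]; last by rewrite mulr0.
rewrite fs //= /switch_sign /s.
by case: (_ \in Z); case: (_ \in Z); rewrite /= ?rmorphN /=; ring.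
Qed.

Section Biadjacency.
Variables (R : realType) (m n : nat) (V : finType) (G : signed_graph V).
Variables (f : V -> 'I_m + 'I_n) (g : 'I_m + 'I_n -> V).
Hypotheses (fK : cancel f g) (gK : cancel g f).
Hypothesis fe : forall u v, edge G u v = Kmn (f u) (f v).

Definition biadj : 'M[R]_(m, n) :=
  \matrix_(i, j) (sign G (g (inl i)) (g (inr j)))%:~R.

Lemma edge_lr i j : edge G (g (inl i)) (g (inr j)).
Proof. by rewrite fe !gK. Qed.

Lemma biadj_sign : sign_mx biadj.
Proof.
move=> i j; rewrite mxE; case: (sign_pm1 (edge_lr i j)) => ->;
by rewrite ?rmorphN ?sqrrN rmorph1 expr1n.
Qed.

(** The value 0 is a placeholder: no edge joins two vertices on the same side. *)
Lemma sign_biadj u v : edge G u v ->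
  (sign G u v)%:~R = match f u, f v with
                     | inl i, inr j | inr j, inl i => biadj i j
                     | _, _ => 0 
                     end :> R.
Proof.
move=> uv; have := uv; rewrite fe; move: (fK u) (fK v).
case: (f u) => i; case: (f v) => j //= <- <- _; rewrite mxE //.
by rewrite (sign_sym (edge_lr _ _)).
Qed.

Lemma char_poly_biadj :
  char_poly (adj_mx R G) = char_poly (block_mx 0 biadj biadj^T 0).
Proof.
apply: (@char_poly_signed_bij _ _ _ (fun i => unsplit (f (enum_val i))) _ _
  (fun=> 1)) => [|i|i j]; rewrite ?expr1n //.
  apply: (bij_comp (h := f \o enum_val)).
    by exists (@fintype.split m n); [exact: unsplitK | exact: splitK].
  by apply: bij_comp (enum_val_bij _); exists g.
rewrite !mul1r [RHS]mxE; case: ifP => [uv|].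
  rewrite sign_biadj //; move: uv; rewrite fe.
  case: (f _) => k; case: (f _) => l //= _.
    by rewrite block_mxEur.
  by rewrite block_mxEdl mxE.
rewrite fe; case: (f _) => k; case: (f _) => l //= _.
  by rewrite block_mxEul mxE.
by rewrite block_mxEdr mxE.
Qed.

(** If the entries are [s i * t j], each edge sign is a product [z u * z v], and along a cycle every
    vertex contributes its sign twice. *)
Lemma unbalanced_biadj : unbalanced G -> ~ sign_rank1 biadj.
Proof.
move=> Gu [s [t [s2 t2 Bst]]]; apply: Gu => c [_ /andP[cc cu]].
pose z (u : V) : R := match f u with inl i => s i | inr j => t j end.
have z2 u : z u ^+ 2 = 1 by rewrite /z; case: (f u).
have zz u v : edge G u v -> (sign G u v)%:~R = z u * z v.
  move=> uv; rewrite sign_biadj // /z; move: uv; rewrite fe.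
  by case: (f u) => i; case: (f v) => j //= _; rewrite Bst // mulrC.
apply: (@intr_inj R); rewrite /cycle_sign rmorph_prod /= big_seq.
rewrite (eq_bigr (fun x => z x * z (next c x))) => [|x xc]; last first.
  by rewrite zz // next_cycle.
rewrite big_split /= -!big_seq.
(* [next] permutes the vertices of a cycle without repetitions. *)
have -> : \prod_(x <- c) z (next c x) = \prod_(x <- c) z x.
  rewrite -[LHS](big_map (next c) xpredT z); apply: perm_big.
  have ni := can_inj (prev_next cu).
  apply: uniq_perm; rewrite ?(map_inj_uniq ni) // => y.
  by rewrite -{1}(next_prev cu y) (mem_map ni) mem_prev.
by rewrite -big_split big1 // => x _; rewrite /= -expr2 z2.
Qed.

Lemma one_negative_edge_biadj : #|negative_edges G| = 1%N ->
  exists i0 j0, biadj = one_neg R i0 j0.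
Proof.
move=> /eqP/cards1P[e eE].
have [i0 [j0 [e0 s0]]] : exists i0 j0, e = [set g (inl i0); g (inr j0)] /\
    sign G (g (inl i0)) (g (inr j0)) = -1.
  have : e \in negative_edges G by rewrite eE inE.
  case/imsetP => -[u v]; rewrite inE /= => /andP[uv /eqP suv] ->.
  have := uv; rewrite fe; move: suv; rewrite -(fK u) -(fK v) !gK.
  case: (f u) => i; case: (f v) => j //= sij _.
    by exists i, j.
  by exists j, i; rewrite finset.setUC (sign_sym (edge_lr _ _)).
exists i0, j0; apply/matrixP => i j; rewrite !mxE.
case: ifP => [/andP[/eqP -> /eqP ->]|ij]; first by rewrite s0 rmorphN rmorph1.
case: (sign_pm1 (edge_lr i j)) => [->|sij]; first by rewrite rmorph1.
have : [set g (inl i); g (inr j)] \in negative_edges G.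
  by apply/imsetP; exists (g (inl i), g (inr j)); rewrite ?inE /= ?edge_lr ?sij.
rewrite eE inE e0 => /eqP/setP E; move: ij.
have := E (g (inl i)); have := E (g (inr j)).
rewrite !inE !eqxx !(can_eq gK) orbT /=.
by rewrite orbF => /esym/eqP[->] /esym/eqP[->]; rewrite !eqxx.
Qed.

End Biadjacency.

(** Switching at the vertices of sign -1 under [s] and [t] leaves one negative edge, which
    transpositions on the two sides carry to that of [H]. *)
Lemma switching_equivalent_biadj (R : realType) m n (V W : finType)
    (G : signed_graph V) (H : signed_graph W)
    (fG : V -> 'I_m + 'I_n) gG (fH : W -> 'I_m + 'I_n) gH i0 j0 i1 j1
    (s : 'I_m -> R) (t : 'I_n -> R) :
  cancel fG gG -> cancel gG fG -> cancel fH gH -> cancel gH fH ->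
  (forall u v, edge G u v = Kmn (fG u) (fG v)) ->
  (forall u v, edge H u v = Kmn (fH u) (fH v)) ->
  (forall i, s i ^+ 2 = 1) -> (forall j, t j ^+ 2 = 1) ->
  (forall i j, biadj R G gG i j = s i * t j * one_neg R i0 j0 i j) ->
  biadj R H gH = one_neg R i1 j1 ->
  switching_equivalent G H.
Proof.
move=> fGK gGK fHK gHK feG feH s2 t2 BG BH.
pose z (u : V) : R := match fG u with inl i => s i | inr j => t j end.
pose p (x : 'I_m + 'I_n) : 'I_m + 'I_n :=
  match x with inl i => inl (tperm i0 i1 i) | inr j => inr (tperm j0 j1 j) end.
have pK : involutive p by case=> k /=; rewrite tpermK.
exists [set u | z u == -1], (gH \o p \o fG); split.
- apply: bij_comp; last by exists gG.
  by apply: bij_comp (inv_bij pK); exists fH.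
- move=> u v; rewrite feH feG /= !gHK.
  by case: (fG u); case: (fG v).
have zE u : z u = if z u == -1 then -1 else 1.
  have /eqP : z u ^+ 2 = 1 by rewrite /z; case: (fG u).
  by rewrite sqrf_eq1 orbC; case: eqP => //= _ /eqP.
move=> u v uv; apply: (@intr_inj R).
have -> : (switch_sign G [set u | z u == -1] u v)%:~R =
    z u * z v * (sign G u v)%:~R :> R.
  rewrite [in RHS](zE u) [in RHS](zE v) /switch_sign !inE.
  by case: (z u == -1); case: (z v == -1); rewrite /= ?rmorphN /=; ring.
have huv : edge H ((gH \o p \o fG) u) ((gH \o p \o fG) v).
  by rewrite feH /= !gHK; move: uv; rewrite /= feG; case: (fG u); case: (fG v).
rewrite (sign_biadj R fHK gHK feH) // /= !gHK.
rewrite (sign_biadj R fGK gGK feG) //.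
have E i j : biadj R H gH (tperm i0 i1 i) (tperm j0 j1 j) =
    s i * t j * biadj R G gG i j.
  rewrite BH BG !mxE !(can2_eq (tpermK _ _) (tpermK _ _)) !tpermR.
  by rewrite mulrA -expr2 exprMn s2 t2 !mul1r.
move: uv; rewrite /= feG /z; case: (fG u) => i; case: (fG v) => j //= _.
by rewrite E (mulrC (t _)).
Qed.

(** * Comparison of the Estrada indices and the case of equality *)

Theorem theorem3p10 (R : realType) (m n : nat) (m_gt0 : (0 < m)%N)
    (n_gt0 : (0 < n)%N)
    (Vstar : finType) (Gstar : signed_graph Vstar)
    (Gstar_unbalanced : unbalanced_Kmn m n Gstar)
    (Gstar_one_neg : #|negative_edges Gstar| = 1%N)
    (V : finType) (G : signed_graph V) (G_unbalanced : unbalanced_Kmn m n G) :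
  estrada R G <= estrada R Gstar /\
  (estrada R Gstar = estrada R G <-> switching_equivalent G Gstar).
Proof.
have [[f [[g fK gK] fe]] Gu] := G_unbalanced.
have [[f' [[g' fK' gK'] fe']] _] := Gstar_unbalanced.
pose B := biadj R G g.
have Bs : sign_mx B by exact: biadj_sign gK fe.
have B1 : ~ sign_rank1 B by exact: unbalanced_biadj fK gK fe Gu.
have [i1 [j1 CE]] := one_negative_edge_biadj R fK' gK' fe' Gstar_one_neg.
have Cs : sign_mx (one_neg R i1 j1) by exact: one_neg_sign.
have [d [e [[dE eE] d0 e0 de tr]]] := gram_spectrum i1 j1 Bs B1.
have EG := estrada_bipartite (char_poly_biadj R fK gK fe) dE d0.
have CP := char_poly_biadj R fK' gK' fe'; rewrite CE in CP.
have EC := estrada_bipartite CP eE e0.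
split; first by rewrite -(lerD2r m%:R) EG EC lerD2l cosh_sqrt_sum_le.
split=> [EE|/switching_equivalent_estrada -> //].
(* Equal indices make all power sums agree; the second one gives equal traces, hence equal numbers
   of negative 4-cycles. *)
have : \sum_i d i ^+ 2 = \sum_i e i ^+ 2.
  by apply: cosh_sqrt_sum_eq => //; apply: (addrI n%:R); rewrite -EG -EC EE.
move=> /tr; rewrite !gram_trace2_weight // => /addrI/oppr_inj.
have four0 : (4 : R) != 0 by rewrite pnatr_eq0.
move=> /(mulfI four0)/eqP; rewrite eqr_nat weight_one_neg => /eqP wE.
have [|i0 [j0 [s [t [s2 t2 BE]]]]] := weight_extremal Bs B1.
  by rewrite wE.
exact: (switching_equivalent_biadj fK gK fK' gK' fe fe' s2 t2 BE CE).
Qed.
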